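(* The class of outer-segment graphs is a strict subclass of the class of outer-string graphs.
   Context: Graphs are finite and simple. For a nonempty family $\mathcal{F}$ of subsets of $\mathbb{R}^2$, the intersection graph $\mathrm{Int}(\mathcal{F})$ has vertex set $\mathcal{F}$, and two distinct members $A,B\in\mathcal{F}$ are adjacent if and only if $A\cap B\neq\emptyset$. A family $\mathcal{F}$ is an intersection model of a graph $G$ if $G$ is isomorphic to $\mathrm{Int}(\mathcal{F})$. - An outer-segment graph is a graph that has an intersection model consisting of straight-line segments lying in a (common) disk such that each segment has an endpoint on the boundary of the disk. - An outer-string graph is a graph that has an intersection model consisting of curves lying in a (common) disk such that each curve has an endpoint on the boundary of the disk. *)

(* Defs.v *)
From HB Require Import structures.
From mathcomp Require Import all_boot all_order all_algebra.
From mathcomp Require Import all_classical all_reals all_analysis.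

Set Implicit Arguments.
Unset Strict Implicit.
Unset Printing Implicit Defensive.

Import Order.TTheory GRing.Theory Num.Theory.
Import numFieldNormedType.Exports.

Local Open Scope classical_set_scope.
Local Open Scope ring_scope.

Record sgraph := SGraph {
  vertex :> finType;
  adj : rel vertex;
  adj_sym : symmetric adj;
  adj_irrefl : irreflexive adj }.

Section IntersectionModels.
Variable R : realType.

Local Notation plane := (R * R)%type.

(* Adjacency in the graph Int(F), whose vertices are the members of F. *)
Definition int_adj (A B : set plane) : Prop := A <> B /\ A `&` B !=set0.

(* F is a set of subsets of the plane, so distinct vertices of G correspond to
   distinct subsets. *)
Definition intersection_model (F : set (set plane)) (G : sgraph) : Prop :=
  F !=set0 /\
  exists f : G -> set plane, set_bij [set: G] F f /\
    forall u v : G, adj u v <-> int_adj (f u) (f v).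

(* The norm that the library puts on R * R is the sup norm, so the Euclidean
   distance is written out. *)
Definition sqdist (p q : plane) : R :=
  (p.1 - q.1) ^+ 2 + (p.2 - q.2) ^+ 2.

Definition disk (c : plane) (r : R) : set plane :=
  [set p | sqdist p c <= r ^+ 2].

Definition circle (c : plane) (r : R) : set plane :=
  [set p | sqdist p c = r ^+ 2].

Definition is_segment (A : set plane) (p q : plane) : Prop :=
  p <> q /\ A = [set (1 - t) *: p + t *: q | t in `[0, 1]].

(* Curves need not be simple, so the endpoints p and q are those of some
   parametrisation of A. *)
Definition is_curve (A : set plane) (p q : plane) : Prop :=
  exists gamma : R -> plane,
    [/\ {within `[0, 1], continuous gamma}, gamma 0 = p, gamma 1 = q
      & A = gamma @` `[0, 1]].

(* [kind A p q] says that A is an object of the given kind with endpoints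
   p and q. *)
Definition outer_graph (kind : set plane -> plane -> plane -> Prop)
    (G : sgraph) : Prop :=
  exists (F : set (set plane)) (c : plane) (r : R),
    [/\ intersection_model F G, 0 < r
      & forall A, F A -> A `<=` disk c r /\
          exists p q, kind A p q /\ (circle c r p \/ circle c r q)].

Definition outer_segment (G : sgraph) : Prop := outer_graph is_segment G.

Definition outer_string (G : sgraph) : Prop := outer_graph is_curve G.

End IntersectionModels.

(* Main.v *)
Require Import Defs.
From mathcomp Require Import all_boot all_order all_algebra.
From mathcomp Require Import all_classical all_reals all_analysis.
From mathcomp Require Import ring lra.

Set Implicit Arguments.
Unset Strict Implicit.
Unset Printing Implicit Defensive.

Import Order.TTheory GRing.Theory Num.Theory.
Import numFieldNormedType.Exports.

Local Open Scope classical_set_scope.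
Local Open Scope ring_scope.

(** A segment with its parametrisation is a curve, so only strictness needs an
argument. It compares how many neighbourhoods can be cut out by segments and by
curves. Let [incidence_graph n] have as vertices the indices [i < n] and the
sets [A] of indices, with each kind forming a clique and [i] adjacent to [A]
when [i \in A].

Segments cannot realize this graph for large [n]. Whether the segment [p q]
meets a fixed segment [c d] depends only on the signs of eight expressions
([segments_meet_only_if], [segments_meet_if]), and each of them is a linear
functional of the vector [(1, p, q, p x q)] of [R^6] ([sign_vector_tests]).
Since [m] linear functionals on [R^d] take at most [(2 m + 1) ^ d] sign vectors
([sign_vectors_bound]), a moving segment has at most [(16 n + 1) ^ 6] patterns
of intersection with [n] fixed ones ([segment_patterns_bound]), whereas the
graph requires all [2 ^ n].

Curves realize it for every [n] ([incidence_outer_string]). Fix distinct points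
on a diameter of the disk, one for each index. The strings of the indices
start at a common point of the circle and run below the diameter, each ending at
its own point there. The strings of the sets start at another common point of
the circle and stay above the diameter, the one of [A] touching it, apart from
its start, exactly at the points with index in [A]. *)

(** * Sign vectors of linear functionals *)

Section SignVectors.
Variable R : realType.

Definition sign_vector d (L : seq 'cV[R]_d) (x : 'rV[R]_d) : seq R :=
  [seq Num.sg ((x *m l) 0 0) | l <- L].

Definition realized d (L : seq 'cV[R]_d) (s : seq R) : Prop :=
  exists x, sign_vector L x = s.

Lemma sgr_pos_comb (a b x y : R) : 0 < a -> 0 < b -> Num.sg x = Num.sg y ->
  Num.sg (a * x + b * y) = Num.sg x.
Proof.
move=> a0 b0; case: (sgrP y) => [->|y0|y0] sx.
- by move/eqP: sx; rewrite sgr_eq0 => /eqP ->; rewrite !mulr0 addr0.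
- have x0 : 0 < x by rewrite -sgr_gt0 sx ltr01.
  by rewrite !gtr0_sg // addr_gt0 // mulr_gt0.
- have x0 : x < 0 by rewrite -sgr_lt0 sx ltrN10.
  by rewrite !ltr0_sg // -oppr_gt0 opprD addr_gt0 // -mulrN mulr_gt0 // oppr_gt0.
Qed.

Lemma sign_vector_pos_comb d (L : seq 'cV[R]_d) (a b : R) (x y : 'rV[R]_d) :
  0 < a -> 0 < b -> sign_vector L x = sign_vector L y ->
  sign_vector L (a *: x + b *: y) = sign_vector L x.
Proof.
move=> a0 b0; elim: L => [//|l L IH] /= [sl sL].
rewrite IH //; congr (_ :: _).
rewrite mulmxDl -!scalemxAl [fun_of_matrix _ _ _]mxE.
by rewrite [X in X + _]mxE [X in _ + X]mxE sgr_pos_comb.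
Qed.

(** A point of the hyperplane [f = 0] on the line segment joining two points on
opposite sides is a positive combination of them. *)
Lemma realized_crossing d (f : 'cV[R]_d) (L : seq 'cV[R]_d) (t : seq R) :
  realized (f :: L) (1 :: t) -> realized (f :: L) (-1 :: t) ->
  realized (f :: L) (0 :: t).
Proof.
move=> [x /= [fx Lx]] [y /= [fy Ly]].
have fx0 : 0 < (x *m f) 0 0 by rewrite -sgr_gt0 fx ltr01.
have fy0 : (y *m f) 0 0 < 0 by rewrite -sgr_lt0 fy ltrN10.
exists (- (y *m f) 0 0 *: x + (x *m f) 0 0 *: y) => /=.
rewrite sign_vector_pos_comb ?oppr_gt0 // ?Lx ?Ly //; congr (_ :: _).
rewrite mulmxDl -!scalemxAl [fun_of_matrix _ _ _]mxE.
rewrite [X in X + _]mxE [X in _ + X]mxE mulNr mulrC addNr; exact: sgr0.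
Qed.

(** The hyperplane [f = 0] is parametrised by a space of one dimension less, on
which the other functionals remain linear. *)
Lemma realized_kernel d (f : 'cV[R]_d) (L : seq 'cV[R]_d) (t : seq R) :
  realized (f :: L) (0 :: t) ->
  realized [seq row_base (kermx f) *m l | l <- L] t.
Proof.
move=> [x /= [/eqP fx Lx]]; rewrite sgr_eq0 in fx.
have /submxP[y xy] : (x <= row_base (kermx f))%MS.
  rewrite eq_row_base; apply/sub_kermxP/matrixP => i j.
  by rewrite !ord1 (eqP fx) mxE.
exists y; rewrite -Lx /sign_vector -map_comp; apply: eq_map => l /=.
by rewrite mulmxA -xy.
Qed.

Lemma leq_exp2 m n d : (m <= n)%N -> (m ^ d <= n ^ d)%N.
Proof. by case: d => // d mn; rewrite leq_exp2r. Qed.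

(** Adding a nonzero functional [f] to [L] extends a sign vector [t] of [L] in a
single way unless [f] vanishes somewhere on the cell of [t], because it does so
as soon as it takes both signs there. The cells on which it vanishes correspond
to sign vectors of the restriction of [L] to the hyperplane [f = 0]. Hence the
largest numbers of sign vectors satisfy
[N (m + 1, d) <= N (m, d) + 2 N (m, d - 1)]. *)
Lemma sign_vectors_bound d (L : seq 'cV[R]_d) (X : seq (seq R)) :
  uniq X -> (forall s, s \in X -> realized L s) ->
  (size X <= (2 * size L + 1) ^ d)%N.
Proof.
have [m sL] : exists m, size L = m by exists (size L).
elim: m d L X sL => [|m IH] d [|f L] X //= sL uX rX.
  rewrite muln0 exp1n; apply: (@uniq_leq_size _ X [:: [::]]) => // s /rX [x <-].
  by rewrite inE.
pose Y := undup (map behead X).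
have rY t : t \in Y -> realized L t.
  by rewrite mem_undup => /mapP[s /rX [x /= <-] ->]; exists x.
have YB : (size Y <= (2 * size L + 1) ^ d)%N.
  by apply: IH rY; [case: sL|exact: undup_uniq].
have XY s : s \in X -> behead s \in Y.
  by move=> sX; rewrite mem_undup; apply/mapP; exists s.
have [f0|f0] := eqVneq f 0.
  apply: (@leq_trans (size Y)); last first.
    by apply: leq_trans YB _; rewrite leq_exp2 // leq_add2r leq_mul2l /= leqnSn.
  rewrite -(size_map (cons 0) Y); apply: uniq_leq_size => // s sX.
  apply/mapP; exists (behead s); first exact: XY.
  by have [x /= <-] := rX _ sX; rewrite f0 mulmx0 mxE sgr0.
pose Z := [seq t <- Y | `[< realized (f :: L) (0 :: t) >]].
have ZB : (size Z <= (2 * size L + 1) ^ d.-1)%N.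
  have <- : \rank (kermx f) = d.-1.
    rewrite mxrank_ker -subn1; congr (d - _)%N; apply/eqP.
    by rewrite eqn_leq rank_leq_col lt0n mxrank_eq0.
  rewrite -(size_map (fun l => row_base (kermx f) *m l) L).
  apply: IH; [by rewrite size_map; case: sL|by rewrite filter_uniq // undup_uniq|].
  by move=> t; rewrite mem_filter => /andP[/asboolP/realized_kernel].
pose e t : R := if `[< realized (f :: L) (0 :: t) >] then 0 else
  if `[< realized (f :: L) (1 :: t) >] then 1 else -1.
(* [e t] is the sign to put in front of [t] when only one is possible; the
   vectors with another sign lie over [Z]. *)
have XYZ : {subset X <= [seq e t :: t | t <- Y] ++
                        ([seq 1 :: t | t <- Z] ++ [seq -1 :: t | t <- Z])}.
  move=> s sX; have := XY _ sX; have [x /=] := rX _ sX.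
  case: s sX => [//|r t] sX [fr Lt] /= tY.
  have rs : realized (f :: L) (r :: t) by exists x; rewrite /= fr Lt.
  rewrite !mem_cat; case: (asboolP (realized (f :: L) (0 :: t))) => r0.
    have tZ : t \in Z by rewrite mem_filter tY andbT; apply/asboolP.
    move: fr; case: sgrP => _ <-.
    - apply/orP; left; apply/mapP; exists t => //.
      by rewrite /e asboolT.
    - by apply/orP; right; apply/orP; left; apply/mapP; exists t.
    - by apply/orP; right; apply/orP; right; apply/mapP; exists t.
  apply/orP; left; apply/mapP; exists t => //; congr (_ :: _).
  rewrite /e asboolF //; move: fr rs; case: sgrP => _ <- rs //.
    by rewrite asboolT.
  by rewrite asboolF // => r1; apply: r0; exact: realized_crossing.
apply: leq_trans (uniq_leq_size uX XYZ) _.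
rewrite !size_cat !size_map.
have d0 : (0 < d)%N.
  by apply: leq_trans (rank_leq_row f); rewrite lt0n mxrank_eq0.
rewrite /=; set a := (2 * size L + 1)%N in YB ZB *.
have -> : (2 * (size L).+1 + 1 = a + 2)%N by rewrite /a mulnS -addnA addnC.
have expd k : (k ^ d = k * k ^ d.-1)%N by rewrite -expnS prednK.
have aZ : (a ^ d.-1 <= (a + 2) ^ d.-1)%N by rewrite leq_exp2 ?leq_addr.
rewrite expd mulnDl leq_add //.
  by apply: leq_trans YB _; rewrite expd leq_mul2l aZ orbT.
rewrite addnn -mul2n leq_mul2l.
exact: leq_trans aZ.
Qed.

End SignVectors.

(** * A sign criterion for the intersection of two segments *)

Section SegmentsMeet.
Variable R : realType.
Local Notation plane := (R * R)%type.

(** Twice the signed area of the triangle [a b c]. *)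
Definition orient (a b c : plane) : R :=
  (b.1 - a.1) * (c.2 - a.2) - (b.2 - a.2) * (c.1 - a.1).

(** Up to the positive factor [|d - c|], the coordinate of the projection of [p]
on the line [c d], measured from [c] towards [d]. *)
Definition abscissa (c d p : plane) : R :=
  (d.1 - c.1) * (p.1 - c.1) + (d.2 - c.2) * (p.2 - c.2).

Definition segment (p q : plane) : set plane :=
  [set (1 - t) *: p + t *: q | t in `[0, 1]].

Lemma segmentP (p q x : plane) : segment p q x <->
  exists t, [/\ 0 <= t, t <= 1, x.1 = (1 - t) * p.1 + t * q.1
                & x.2 = (1 - t) * p.2 + t * q.2].
Proof.
split=> [[t /=]|[t [t0 t1 x1 x2]]].
  by rewrite in_itv /= => /andP[t0 t1] <-; exists t.
exists t => /=; first by rewrite in_itv /= t0.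
by rewrite (surjective_pairing x) x1 x2.
Qed.

Lemma convex_zero (x y : R) : x * y <= 0 ->
  exists t, [/\ 0 <= t, t <= 1 & (1 - t) * x + t * y = 0].
Proof.
move=> xy; have [exy|nxy] := eqVneq x y.
  exists 0; split=> //; rewrite subr0 mul1r mul0r addr0; apply/eqP.
  by rewrite -sqrf_eq0 eq_le sqr_ge0 andbT expr2 {2}exy.
have d0 : x - y != 0 by rewrite subr_eq0.
have d2 : 0 < (x - y) ^+ 2 by rewrite exprn_even_gt0.
exists (x / (x - y)).
have -> : x / (x - y) = (x * (x - y)) / (x - y) ^+ 2 by field.
split.
- by rewrite divr_ge0 ?(ltW d2) // mulrBr -expr2 subr_ge0 (le_trans xy) ?sqr_ge0.
- rewrite ler_pdivrMr // mul1r; rewrite -subr_ge0.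
  have -> : (x - y) ^+ 2 - x * (x - y) = y ^+ 2 - x * y by ring.
  by rewrite subr_ge0 (le_trans xy) ?sqr_ge0.
- by field.
Qed.

(** If one of the conditions fails, a line separates the two segments: one of
the lines [c d] and [p q], or a line perpendicular to [c d] through [c] or
[d]. *)
Lemma segments_meet_only_if (p q c d : plane) :
  segment p q `&` segment c d !=set0 ->
  [/\ orient c d p * orient c d q <= 0,
      orient p q c * orient p q d <= 0,
      (0 <= abscissa c d p) || (0 <= abscissa c d q) &
      (abscissa d c p >= 0) || (abscissa d c q >= 0)].
Proof.
case=> x [/segmentP[s [s0 s1 xs1 xs2]] /segmentP[t [t0 t1 xt1 xt2]]].
have e1 : (1 - s) * p.1 + s * q.1 = (1 - t) * c.1 + t * d.1 by rewrite -xs1.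
have e2 : (1 - s) * p.2 + s * q.2 = (1 - t) * c.2 + t * d.2 by rewrite -xs2.
have opp_sides (a b r : R) : 0 <= r -> r <= 1 -> (1 - r) * a + r * b = 0 -> a * b <= 0.
  move=> r0 r1 e; have -> : a * b = - ((1 - r) * a ^+ 2 + r * b ^+ 2).
    by apply/eqP; rewrite -subr_eq0; apply/eqP; rewrite -(mulr0 (a + b)) -e; ring.
  by rewrite oppr_le0 addr_ge0 // mulr_ge0 ?sqr_ge0 ?subr_ge0.
have nonneg_end (a b : R) : 0 <= (1 - s) * a + s * b -> (0 <= a) || (0 <= b).
  move=> ab; case: (leP 0 a) => //= a0; rewrite leNgt.
  by apply/negP => b0; case: (leP a b) => ?; nra.
split.
- apply: (opp_sides _ _ s) => //.
  transitivity (orient c d ((1 - s) * p.1 + s * q.1, (1 - s) * p.2 + s * q.2)).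
    by rewrite /orient /=; ring.
  by rewrite e1 e2 /orient /=; ring.
- apply: (opp_sides _ _ t) => //.
  transitivity (orient p q ((1 - t) * c.1 + t * d.1, (1 - t) * c.2 + t * d.2)).
    by rewrite /orient /=; ring.
  by rewrite -e1 -e2 /orient /=; ring.
- apply: nonneg_end.
  have -> : (1 - s) * abscissa c d p + s * abscissa c d q =
    abscissa c d ((1 - s) * p.1 + s * q.1, (1 - s) * p.2 + s * q.2).
    by rewrite /abscissa /=; ring.
  rewrite e1 e2.
  have -> : abscissa c d ((1 - t) * c.1 + t * d.1, (1 - t) * c.2 + t * d.2) =
    t * ((d.1 - c.1) ^+ 2 + (d.2 - c.2) ^+ 2) by rewrite /abscissa /=; ring.
  by rewrite mulr_ge0 // addr_ge0 // sqr_ge0.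
- apply: nonneg_end.
  have -> : (1 - s) * abscissa d c p + s * abscissa d c q =
    abscissa d c ((1 - s) * p.1 + s * q.1, (1 - s) * p.2 + s * q.2).
    by rewrite /abscissa /=; ring.
  rewrite e1 e2.
  have -> : abscissa d c ((1 - t) * c.1 + t * d.1, (1 - t) * c.2 + t * d.2) =
    (1 - t) * ((d.1 - c.1) ^+ 2 + (d.2 - c.2) ^+ 2) by rewrite /abscissa /=; ring.
  by rewrite mulr_ge0 ?subr_ge0 // addr_ge0 // sqr_ge0.
Qed.

Lemma intervals_meet (a b : R) : (0 <= a) || (0 <= b) -> (a <= 1) || (b <= 1) ->
  exists s t, [/\ 0 <= s, s <= 1, 0 <= t, t <= 1 & (1 - s) * a + s * b = t].
Proof.
move=> ab0 ab1.
have [a0|a0] := leP 0 a; have [a1|a1] := leP a 1.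
- by exists 0, a; split=> //; ring.
- rewrite leNgt a1 /= in ab1; have [b0|b0] := leP 0 b.
    by exists 1, b; split=> //; ring.
  have [|s [s0 s1 e]] := @convex_zero a b; first by nra.
  by exists s, 0; split.
- rewrite leNgt a0 /= in ab0; have [b1|b1] := leP b 1.
    by exists 1, b; split=> //; ring.
  have [|s [s0 s1 e]] := @convex_zero a b; first by nra.
  by exists s, 0; split.
- lra.
Qed.

(** If the lines [p q] and [c d] cross, the two orientation conditions place the
crossing point on both segments. If their directions are parallel, the first
condition puts [p] and [q] on the line [c d], and the conditions on the
projections say that two intervals of this line meet. *)
Lemma segments_meet_if (p q c d : plane) : c <> d ->
  orient c d p * orient c d q <= 0 ->
  orient p q c * orient p q d <= 0 ->
  (0 <= abscissa c d p) || (0 <= abscissa c d q) ->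
  (0 <= abscissa d c p) || (0 <= abscissa d c q) ->
  segment p q `&` segment c d !=set0.
Proof.
move=> cd opq ocd apq adq.
suff [s [t [s0 s1 t0 t1 [e1 e2]]]] : exists s t, [/\ 0 <= s, s <= 1, 0 <= t, t <= 1 &
    (1 - s) * p.1 + s * q.1 = (1 - t) * c.1 + t * d.1 /\
    (1 - s) * p.2 + s * q.2 = (1 - t) * c.2 + t * d.2].
  exists ((1 - s) * p.1 + s * q.1, (1 - s) * p.2 + s * q.2); split.
    by apply/segmentP; exists s.
  by apply/segmentP; exists t.
(* The cross product of the two directions. *)
pose D := (q.1 - p.1) * (d.2 - c.2) - (q.2 - p.2) * (d.1 - c.1).
have [D0|D0] := eqVneq D 0.
  pose N := (d.1 - c.1) ^+ 2 + (d.2 - c.2) ^+ 2.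
  have N0 : 0 < N.
    rewrite lt_neqAle eq_sym addr_ge0 ?sqr_ge0 // andbT.
    rewrite paddr_eq0 ?sqr_ge0 // !sqrf_eq0 !subr_eq0.
    apply/negP => /andP[/eqP d1 /eqP d2]; apply: cd.
    by rewrite (surjective_pairing c) -d1 -d2 -surjective_pairing.
  have oq : orient c d q = orient c d p.
    by apply/eqP; rewrite -subr_eq0 -oppr_eq0 -D0 /orient /D; apply/eqP; ring.
  have op : orient c d p = 0.
    by apply/eqP; rewrite -sqrf_eq0 eq_le sqr_ge0 andbT expr2 -{2}oq.
  rewrite op in oq.
  have onl x : orient c d x = 0 ->
      x.1 = c.1 + abscissa c d x / N * (d.1 - c.1) /\
      x.2 = c.2 + abscissa c d x / N * (d.2 - c.2).
    move=> ox; split; apply: (mulIf (lt0r_neq0 N0)); rewrite mulrDl;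
      rewrite [_ / N * _ * _]mulrAC divfK ?lt0r_neq0 //;
      apply/eqP; rewrite -subr_eq0; apply/eqP.
      transitivity (- (d.2 - c.2) * orient c d x); last by rewrite ox mulr0.
      by rewrite /N /abscissa /orient; ring.
    transitivity ((d.1 - c.1) * orient c d x); last by rewrite ox mulr0.
    by rewrite /N /abscissa /orient; ring.
  have [p1 p2] := onl p op; have [q1 q2] := onl q oq.
  have ad x : abscissa d c x = N - abscissa c d x by rewrite /abscissa /N; ring.
  have [||s [t [s0 s1 t0 t1 e]]] := @intervals_meet (abscissa c d p / N) (abscissa c d q / N).
  - by rewrite !ler_pdivlMr // mul0r.
  - by rewrite !ler_pdivrMr // mul1r -!(subr_ge0 _ N) -!ad.
  exists s, t; split=> //; rewrite p1 p2 q1 q2 -e; split; ring.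
have [s [s0 s1 es]] := convex_zero opq; have [t [t0 t1 et]] := convex_zero ocd.
exists s, t; split=> //.
(* [w] joins the two points; it is parallel to both lines, which cross. *)
pose w1 := (1 - s) * p.1 + s * q.1 - ((1 - t) * c.1 + t * d.1).
pose w2 := (1 - s) * p.2 + s * q.2 - ((1 - t) * c.2 + t * d.2).
have c1 : (d.1 - c.1) * w2 - (d.2 - c.2) * w1 = 0.
  by rewrite -[RHS]es /orient /w1 /w2; ring.
have c2 : (q.1 - p.1) * w2 - (q.2 - p.2) * w1 = 0.
  by rewrite -[RHS]oppr0 -[in RHS]et /orient /w1 /w2; ring.
split; apply/eqP; rewrite -subr_eq0 -(mulrI_eq0 _ (lregP D0)).
  apply/eqP; transitivity ((d.1 - c.1) * 0 - (q.1 - p.1) * 0 : R); last by ring.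
  by rewrite -{1}c2 -c1 /D -/w1; ring.
apply/eqP; transitivity ((d.2 - c.2) * 0 - (q.2 - p.2) * 0 : R); last by ring.
by rewrite -{1}c2 -c1 /D -/w2; ring.
Qed.

End SegmentsMeet.

(** * Counting intersection patterns of segments *)

Section Patterns.
Variable R : realType.
Local Notation plane := (R * R)%type.

(** The coordinate [p.1 * q.2 - p.2 * q.1], together with the differences of the
others, makes [orient p q c] linear although it is quadratic in [p] and [q]. *)
Definition pluecker (p q : plane) : 'rV[R]_6 :=
  \row_i nth 0 [:: 1; p.1; p.2; q.1; q.2; p.1 * q.2 - p.2 * q.1] i.

Definition functional (s : seq R) : 'cV[R]_6 := \col_i nth 0 s i.

Definition tests (c d : plane) : seq 'cV[R]_6 :=
  let e := (d.1 - c.1, d.2 - c.2) in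
  let k := c.1 * e.2 - c.2 * e.1 in
  let h x := - (e.1 * x.1 + e.2 * x.2) in
  map functional
  [:: [:: k; - e.2; e.1; 0; 0; 0];
      [:: k; 0; 0; - e.2; e.1; 0];
      [:: 0; - c.2; c.1; c.2; - c.1; 1];
      [:: 0; - d.2; d.1; d.2; - d.1; 1];
      [:: h c; e.1; e.2; 0; 0; 0];
      [:: h c; 0; 0; e.1; e.2; 0];
      [:: - h d; - e.1; - e.2; 0; 0; 0];
      [:: - h d; 0; 0; - e.1; - e.2; 0]].

Lemma sign_vector_tests (c d p q : plane) :
  sign_vector (tests c d) (pluecker p q) =
  map Num.sg [:: orient c d p; orient c d q; orient p q c; orient p q d;
                 abscissa c d p; abscissa c d q;
                 abscissa d c p; abscissa d c q].
Proof.
rewrite /sign_vector /tests -map_comp /=.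
by do 8?[congr (Num.sg _ :: _);
  first by rewrite mxE !big_ord_recl big_ord0 !mxE /= /orient /abscissa; ring].
Qed.

Lemma meet_from_signs (c d p q p' q' : plane) : c <> d ->
  sign_vector (tests c d) (pluecker p q) =
    sign_vector (tests c d) (pluecker p' q') ->
  segment p q `&` segment c d !=set0 -> segment p' q' `&` segment c d !=set0.
Proof.
rewrite !sign_vector_tests => cd [s1 s2 s3 s4 s5 s6 s7 s8].
move=> /segments_meet_only_if [h1 h2 h3 h4]; apply: segments_meet_if => //.
- by rewrite -sgr_le0 sgrM -s1 -s2 -sgrM sgr_le0.
- by rewrite -sgr_le0 sgrM -s3 -s4 -sgrM sgr_le0.
- by rewrite -sgr_ge0 -s5 sgr_ge0 -[in X in _ || X]sgr_ge0 -s6 sgr_ge0.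
- by rewrite -sgr_ge0 -s7 sgr_ge0 -[in X in _ || X]sgr_ge0 -s8 sgr_ge0.
Qed.

(** Sets with the same sign vector would have the same members, by
[meet_from_signs]; so the map sending a set to its sign vector is injective. *)
Lemma segment_patterns_bound n (c d : 'I_n -> plane)
    (p q : {set 'I_n} -> plane) :
  (forall i, c i <> d i) ->
  (forall (S : {set 'I_n}) i, i \in S <->
     segment (p S) (q S) `&` segment (c i) (d i) !=set0) ->
  (2 ^ n <= (16 * n + 1) ^ 6)%N.
Proof.
move=> cd meet.
pose L := flatten [seq tests (c i) (d i) | i <- enum 'I_n].
have sL : (16 * n = 2 * size L)%N.
  rewrite size_flatten sumnE /shape 2!big_map big_enum.
  rewrite (eq_bigr (fun=> 8%N)) // sum_nat_const card_ord.
  by rewrite [(n * 8)%N]mulnC mulnA.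
pose v S := sign_vector L (pluecker (p S) (q S)).
have v_sub S T : v S = v T -> S \subset T.
  move=> /eq_in_map vST; apply/fintype.subsetP => i; rewrite !meet.
  apply: meet_from_signs => //; apply/eq_in_map => l li; apply: vST.
  by apply/flatten_mapP; exists i; rewrite ?mem_enum.
have v_inj : injective v.
  by move=> S T vST; apply/eqP; rewrite finset.eqEsubset !v_sub.
rewrite sL -(card_ord n) -cardsT -card_powerset powersetT cardsT cardE -(size_map v).
apply: sign_vectors_bound; first by rewrite map_inj_uniq ?enum_uniq.
by move=> _ /mapP[S _ ->]; exists (pluecker (p S) (q S)).
Qed.

End Patterns.

(** * The incidence graph is not an outer-segment graph *)

Definition incidence_rel n : rel ('I_n + {set 'I_n}) := fun u v =>
  match u, v with
  | inl i, inl j => i != j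
  | inr A, inr B => A != B
  | inl i, inr A | inr A, inl i => i \in A
  end.

Lemma incidence_sym n : symmetric (@incidence_rel n).
Proof. by move=> [i|S] [j|T] //=; rewrite eq_sym. Qed.

Lemma incidence_irrefl n : irreflexive (@incidence_rel n).
Proof. by move=> [i|S] /=; rewrite eqxx. Qed.

Definition incidence_graph n : sgraph :=
  SGraph (@incidence_sym n) (@incidence_irrefl n).

Lemma incidence_not_outer_segment (R : realType) n :
  ((16 * n + 1) ^ 6 < 2 ^ n)%N -> ~ outer_segment R (incidence_graph n).
Proof.
move=> n_big [F [ctr [r [[_ [f [[fF f_inj _] adjE]]] _ segF]]]].
have /choice[e fe] : forall u : incidence_graph n, exists pq,
    is_segment (f u) pq.1 pq.2.
  move=> u; have [_ [p [q [fu _]]]] := segF _ (fF u I).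
  by exists (p, q).
have f_neq u v : u != v -> f u <> f v.
  by move=> uv fuv; move/eqP: uv; apply; apply: f_inj fuv; rewrite in_setE.
have fE u : f u = segment (e u).1 (e u).2 by have [] := fe u.
suff : (2 ^ n <= (16 * n + 1) ^ 6)%N by rewrite leqNgt n_big.
apply: (@segment_patterns_bound R n (fun i => (e (inl i)).1) (fun i => (e (inl i)).2)
  (fun S => (e (inr S)).1) (fun S => (e (inr S)).2)).
  by move=> i; have [] := fe (inl i).
move=> S i; rewrite -!fE; split=> [iS|Si].
  by have [/(_ iS) []] := adjE (inr S) (inl i).
by apply/(adjE (inr S) (inl i)); split=> //; exact: f_neq.
Qed.

Lemma exists_big_incidence : exists n, ((16 * n + 1) ^ 6 < 2 ^ n)%N.
Proof.
(* For this [n] the left-hand side is [2049 ^ 6], below [(2 ^ 12) ^ 6]. *)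
exists (2 ^ 7)%N; apply: (@leq_ltn_trans ((2 ^ 12) ^ 6)%N).
  by rewrite leq_exp2r.
by rewrite -expnM ltn_exp2l.
Qed.

(** * Curves, and an outer-string model of the incidence graph *)

Section OuterStringModel.
Variable R : realType.
Local Notation plane := (R * R)%type.

Lemma segment_is_curve (A : set plane) (p q : plane) :
  is_segment A p q -> is_curve A p q.
Proof.
move=> [_ ->]; exists (fun t : R => (1 - t) *: p + t *: q); split=> //.
- apply: continuous_subspaceT => t; apply: cvgD; apply: cvgZr_tmp.
    by apply: cvgB; [exact: cvg_cst|exact: cvg_id].
  exact: cvg_id.
- by rewrite subr0 scale1r scale0r addr0.
- by rewrite subrr scale1r scale0r add0r.
Qed.

Definition node (i : nat) : R := i.+1%:R^-1.

Lemma node_gt0 i : 0 < node i.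
Proof. by rewrite invr_gt0 ltr0n. Qed.

Lemma node_le1 i : node i <= 1.
Proof. by rewrite invf_le1 ?ler1n ?ltr0n. Qed.

Lemma node_inj : injective node.
Proof. by move=> i j /invr_inj/eqP; rewrite eqr_nat eqSS => /eqP. Qed.

(** The factor ['X] makes all these curves start at the origin, and the squares
keep them above the axis. *)
Definition height n (A : {set 'I_n}) : {poly R} :=
  'X * \prod_(k in A) ('X - (node k)%:P) ^+ 2.

Lemma heightE n (A : {set 'I_n}) t :
  (height A).[t] = t * \prod_(k in A) (t - node k) ^+ 2.
Proof.
rewrite /height hornerM hornerX horner_prod; congr (_ * _).
by apply: eq_bigr => k _; rewrite horner_exp hornerXsubC.
Qed.

(** The upper bound keeps the curve in the disk of centre [(1, 0)] and radius
[1], which contains the points with [0 <= y <= x <= 1]. *)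
Lemma height_bounds n (A : {set 'I_n}) t : 0 <= t -> t <= 1 ->
  0 <= (height A).[t] <= t.
Proof.
move=> t0 t1; rewrite heightE.
have /andP[p0 p1] : 0 <= \prod_(k in A) (t - node k) ^+ 2 <= 1.
  apply: (big_ind (fun x => 0 <= x <= 1)); first by rewrite ler01 lexx.
    by move=> x y /andP[x0 x1] /andP[y0 y1]; rewrite mulr_ge0 // mulr_ile1.
  move=> k _; rewrite sqr_ge0 /=.
  by have := node_gt0 k; have := node_le1 k; nra.
by rewrite mulr_ge0 //= ler_piMr.
Qed.

Lemma height_node n (A : {set 'I_n}) (i : 'I_n) :
  (height A).[node i] = 0 <-> i \in A.
Proof.
rewrite heightE; split=> [/eqP|iA]; last first.
  by rewrite (bigD1 i) //= subrr expr0n /= mul0r mulr0.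
rewrite mulf_eq0 gt_eqF ?node_gt0 //= => /prodf_eq0[k kA].
by rewrite sqrf_eq0 subr_eq0 => /eqP/node_inj/ord_inj ->.
Qed.

(** The segment from [(1, -1)], the lowest point of the circle, to the point
[(node i, 0)] of the axis. *)
Definition stem (i : nat) (t : R) : plane := (1 - t * (1 - node i), t - 1).

Definition wave n (A : {set 'I_n}) (t : R) : plane := (t, (height A).[t]).

Definition trace n (u : incidence_graph n) : R -> plane :=
  match u with inl i => stem i | inr A => wave A end.

Definition string n (u : incidence_graph n) : set plane := trace u @` `[0, 1].

Lemma continuous_pair (f g : R -> R) : continuous f -> continuous g ->
  continuous (fun t => (f t, g t) : plane).
Proof. by move=> fc gc t; exact: cvg_pair (fc t) (gc t). Qed.

Lemma trace_continuous n (u : incidence_graph n) : continuous (trace u).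
Proof.
case: u => [i|A]; apply: continuous_pair => t.
- apply: cvgB; first exact: cvg_cst.
  by apply: cvgM; [exact: cvg_id|exact: cvg_cst].
- by apply: cvgB; [exact: cvg_id|exact: cvg_cst].
- exact: cvg_id.
- exact: continuous_horner.
Qed.

Lemma stems_meet n (i : 'I_n) : string (inl i) (1, -1).
Proof.
exists 0 => /=; first by rewrite in_itv /= lexx ler01.
by rewrite /stem mul0r subr0 sub0r.
Qed.

Lemma waves_meet n (A : {set 'I_n}) : @string n (inr A) (0, 0).
Proof.
exists 0 => /=; first by rewrite in_itv /= lexx ler01.
by rewrite /wave heightE mul0r.
Qed.

(** The hypothesis [0 <= y] excludes the rest of the string, which lies below
the axis. *)
Lemma stem_axis n (i : 'I_n) (x y : R) : 0 <= y ->
  string (inl i) (x, y) <-> x = node i /\ y = 0.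
Proof.
move=> y0; split=> [[t /=]|[-> ->]].
  rewrite in_itv /= => /andP[t0 t1] [<- ty].
  have t_eq1 : t = 1 by lra.
  by split; [rewrite t_eq1; ring|lra].
exists 1 => /=; first by rewrite in_itv /= lexx ler01.
by rewrite /stem; congr (_, _); ring.
Qed.

Lemma wave_axis n (A : {set 'I_n}) (i : 'I_n) :
  @string n (inr A) (node i, 0) <-> i \in A.
Proof.
rewrite -height_node; split=> [[t _ [-> ->]] //|hi].
exists (node i); last by rewrite /= /wave hi.
by rewrite /= in_itv /= node_le1 ltW ?node_gt0.
Qed.

Lemma wave_ge0 n (A : {set 'I_n}) z : @string n (inr A) z -> 0 <= z.2.
Proof.
by case=> t /=; rewrite in_itv /= => /andP[t0 t1] <-; case/andP: (height_bounds A t0 t1).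
Qed.

Lemma stem_wave_meet n (i : 'I_n) (A : {set 'I_n}) :
  string (inl i) `&` @string n (inr A) !=set0 <-> i \in A.
Proof.
split=> [[[x y] [zi zA]]|iA].
  have /(stem_axis i x) [/(_ zi) [ex ey] _] := wave_ge0 zA.
  by apply/wave_axis; rewrite -ex -ey.
exists (node i, 0); split; last exact/wave_axis.
by apply/stem_axis.
Qed.

Lemma stem_neq_wave n (i : 'I_n) (A : {set 'I_n}) :
  string (inl i) <> @string n (inr A).
Proof.
move=> iA; have := stems_meet i; rewrite iA => /wave_ge0 /=.
by rewrite oppr_ge0 ler10.
Qed.

Lemma string_inj n : injective (@string n).
Proof.
move=> [i|A] [j|B] // uv.
- have [_ /(_ (conj erefl erefl))] := stem_axis i (node i) (lexx 0).
  rewrite uv => /(stem_axis j (node i) (lexx 0)) [/node_inj/ord_inj -> _] //.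
- by case: (stem_neq_wave uv).
- by case: (stem_neq_wave (esym uv)).
- congr inr; apply/setP => k.
  by apply/idP/idP => /wave_axis; [rewrite uv|rewrite -uv] => /wave_axis.
Qed.

Lemma string_adj n (u v : incidence_graph n) :
  adj u v <-> int_adj (string u) (string v).
Proof.
have neq w z : w != z -> @string n w <> string z.
  by move=> wz /string_inj e; rewrite e eqxx in wz.
case: u v => [i|A] [j|B]; split=> /=.
- by move=> ij; split; [exact: neq|exists (1, -1); split; exact: stems_meet].
- by case=> ij _; apply/eqP => e; apply: ij; rewrite e.
- by move=> iB; split; [exact: neq|exact/stem_wave_meet].
- by case=> _ /stem_wave_meet.
- by move=> jA; split; [exact: neq|rewrite setIC; exact/stem_wave_meet].
- by case=> _; rewrite setIC => /stem_wave_meet.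
- by move=> AB; split; [exact: neq|exists (0, 0); split; exact: waves_meet].
- by case=> AB _; apply/eqP => e; apply: AB; rewrite e.
Qed.

(** The disk has centre [(1, 0)] and radius [1]; its circle contains the two
common starting points [(1, -1)] and [(0, 0)]. *)
Lemma incidence_outer_string n : outer_string R (incidence_graph n).
Proof.
exists (range (@string n)), (1, 0), 1; split=> //.
  split; first by exists (@string n (inr finset.set0)), (inr finset.set0).
  exists (@string n); split; last exact: string_adj.
  by split=> [u|u v _ _ /string_inj|A [u _ <-]] //; exists u.
move=> _ [u _ <-]; split.
  move=> _ [t /= + <-]; rewrite in_itv /= => /andP[t0 t1].
  rewrite /disk /= /sqdist expr1n; case: u => [i|A] /=.
    by have := node_gt0 i; have := node_le1 i; nra.
  by have /andP[] := height_bounds A t0 t1; nra.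
exists (trace u 0), (trace u 1); split.
  exists (trace u); split=> //; apply: continuous_subspaceT.
  exact: trace_continuous.
left; rewrite /circle /= /sqdist; case: u => [i|A] /=; first by ring.
by rewrite heightE; ring.
Qed.

End OuterStringModel.

Theorem mainTheorem5 (R : realType) :
  (forall G : sgraph, outer_segment R G -> outer_string R G) /\
  (exists G : sgraph, outer_string R G /\ ~ outer_segment R G).
Proof.
split=> [G [F [c [r [model r0 segF]]]]|].
  exists F, c, r; split=> // A /segF[Ad [p [q [Apq pq]]]]; split=> //.
  by exists p, q; split=> //; exact: segment_is_curve.
have [n n_big] := exists_big_incidence.
exists (incidence_graph n); split; last exact: incidence_not_outer_segment.
exact: incidence_outer_string.
Qed.
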